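(* Let $A\subset\mathbb{R}$ be a finite set with $|A|\ge2$. Then $$|A|\lesssim d^{+}_*(A)\cdot d^{\times}_*(A).$$
   Context: $d^{+}_*(A)=\min_{B}\frac{|AB|^2}{|A||B|}$ and $d^{\times}_*(A)=\min_{B}\frac{|A+B|^2}{|A||B|}$, where in both cases the minimum is over nonempty finite sets $B\subset\mathbb{R}$, $AB=\{ab:a\in A,b\in B\}$ and $A+B=\{a+b:a\in A,b\in B\}$. The notation $a\lesssim b$ means $a\le K\,b\,(\log|A|)^c$ for absolute constants $K,c>0$.
   Formalization: In the definition of d^+_*(A) the minimum is taken over nonempty finite B other than B={0}; with B={0} allowed the ratio would be 1/|A| and the inequality would fail, e.g. for A={1,...,n} with n large. *)

(* Defs.v *)
From HB Require Import structures.
From mathcomp Require Import all_boot all_order all_algebra finmap.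
From mathcomp Require Import all_classical all_reals all_analysis.

Set Implicit Arguments.
Unset Strict Implicit.
Unset Printing Implicit Defensive.

Import Order.TTheory GRing.Theory Num.Theory.

Local Open Scope fset_scope.
Local Open Scope ring_scope.

Definition prodset (R : realType) (A B : {fset R}) : {fset R} :=
  [fset a * b | a in A, b in B].

Definition sumset (R : realType) (A B : {fset R}) : {fset R} :=
  [fset a + b | a in A, b in B].

Definition prod_ratio (R : realType) (A B : {fset R}) : R :=
  #|` prodset A B|%:R ^+ 2 / (#|` A|%:R * #|` B|%:R).

Definition sum_ratio (R : realType) (A B : {fset R}) : R :=
  #|` sumset A B|%:R ^+ 2 / (#|` A|%:R * #|` B|%:R).

(* The superscript of d_*^+ is that of the additive structure it controls; its
   definition is through the product set, and conversely for d_*^x.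

   Both infima are minima as soon as |A| >= 2: see [dplus_min], [dtimes_min].

   B = {0} is excluded from the first minimum: A{0} = {0} would give the
   degenerate ratio 1/|A| whatever A is.  A set B <> {0} may contain 0. *)
Definition dplus (R : realType) (A : {fset R}) : R :=
  inf [set prod_ratio A B | B in [set B | B != fset0 /\ B != [fset 0]]]%classic.

Definition dtimes (R : realType) (A : {fset R}) : R :=
  inf [set sum_ratio A B | B in [set B | B != fset0]]%classic.

Lemma min_ratio_nat (R : realType) (a : nat) (P : nat * nat -> Prop) :
  (0 < a)%N -> (exists p, P p) -> (forall p, P p -> (0 < p.2 <= p.1)%N) ->
  exists2 p, P p & forall q, P q ->
    p.1%:R ^+ 2 / (a%:R * p.2%:R) <= q.1%:R ^+ 2 / (a%:R * q.2%:R) :> R.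
Proof.
move=> a0 [p0 Pp0] Pb.
pose v (p : nat * nat) : R := p.1%:R ^+ 2 / (a%:R * p.2%:R).
pose N := (p0.1 ^ 2).+1.
pose T := ('I_N * 'I_N)%type.
pose g (t : T) : nat * nat := (val t.1, val t.2).
have /andP[p020 p021] := Pb _ Pp0.
have l1 : (p0.1 < N)%N by rewrite ltnS -mulnn leq_pmulr// (leq_trans p020).
have l2 : (p0.2 < N)%N by exact: leq_ltn_trans l1.
pose t0 : T := (Ordinal l1, Ordinal l2).
have gt0 : g t0 = p0 by rewrite /g /=; case: (p0).
have Pt0 : `[< P (g t0) >] by apply/asboolP; rewrite gt0.
case: (@arg_minP _ _ _ t0 (fun t => `[< P (g t) >]) (fun t => v (g t)) Pt0).
move=> t /asboolP Pt tmin; exists (g t) => // q Pq.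
rewrite -/(v (g t)) -/(v q).
have [lq|lq] := leP (v p0) (v q).
  by rewrite (le_trans _ lq)// -gt0; apply: tmin.
have /andP[q20 q21] := Pb _ Pq.
have q1N : (q.1 < N)%N.
  move: lq; rewrite /v ltr_pdivrMr ?mulr_gt0 ?ltr0n// mulrAC ltr_pdivlMr ?mulr_gt0 ?ltr0n//.
  rewrite -!natrX -!natrM ltr_nat => lq.
  rewrite ltnS leqNgt; apply/negP => h.
  have : (p0.1 ^ 2 * (a * q.2) <= q.1 ^ 2 * (a * p0.2))%N.
    rewrite !(mulnCA _ a) leq_pmul2l//.
    apply: (@leq_trans (q.1 * q.1)).
      by rewrite leq_mul// ltnW.
    by rewrite mulnn leq_pmulr.
  by rewrite leqNgt lq.
have q2N : (q.2 < N)%N by exact: leq_ltn_trans q1N.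
have E : g (Ordinal q1N, Ordinal q2N) = q by rewrite /g /=; case: (q).
by rewrite -E; apply: tmin; apply/asboolP; rewrite E.
Qed.

Lemma inf_ratio (R : realType) (A : {fset R}) (f : {fset R} -> {fset R})
    (C : {fset R} -> Prop) (r : {fset R} -> R) :
  r = (fun B => #|` f B|%:R ^+ 2 / (#|` A|%:R * #|` B|%:R)) ->
  (0 < #|` A|)%N -> (exists B, C B) ->
  (forall B, C B -> (0 < #|` B| <= #|` f B|)%N) ->
  let m := inf [set r B | B in [set B | C B]]%classic in
  (exists2 B, C B & r B = m) /\ (forall B, C B -> m <= r B).
Proof.
move=> -> A0 [B0 CB0] Cb /=.
pose P (p : nat * nat) := exists2 B, C B & p = (#|` f B|, #|` B|).
have [||_ [B CB ->] Bmin] := @min_ratio_nat R _ P A0.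
- by exists (#|` f B0|, #|` B0|); exists B0.
- by move=> _ [B CB ->]; apply: Cb.
set S := (X in inf X).
have lbS : lbound S (#|` f B|%:R ^+ 2 / (#|` A|%:R * #|` B|%:R)).
  by move=> _ [B' CB' <-]; apply: (Bmin (#|` f B'|, #|` B'|)); exists B'.
have hS : has_lbound S by eexists; exact: lbS.
split; last by move=> B' CB'; apply: ge_inf => //; exists B'.
exists B => //; apply/eqP; rewrite eq_le; apply/andP; split.
  by apply: lb_le_inf => //; eexists; exists B; first exact: CB.
by apply: ge_inf => //; exists B.
Qed.

Lemma dplus_min (R : realType) (A : {fset R}) : (2 <= #|` A|)%N ->
  (exists B, [/\ B != fset0, B != [fset 0] & prod_ratio A B = dplus A]) /\
  (forall B, B != fset0 -> B != [fset 0] -> dplus A <= prod_ratio A B).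
Proof.
move=> A2.
have [|B|[B [B0 B1] BE] Bmin] := @inf_ratio R A (prodset A)
    (fun B => B != fset0 /\ B != [fset 0]) (prod_ratio A) erefl (ltnW A2).
- exists [fset 1]; split; apply/eqP => /fsetP/(_ 1); rewrite !inE ?eqxx//.
  by rewrite oner_eq0.
- case=> B0 _; rewrite cardfs_gt0 B0 /=.
  have [a /andP[aA a0]] : exists a, (a \in A) && (a != 0).
    apply/not_existsP => h; move: A2; rewrite leqNgt ltnS => /negP; apply.
    rewrite -(cardfs1 (0 : R)); apply/fsubset_leq_card/fsubsetP => x xA.
    by rewrite inE; apply/negP => /negP x0; apply: (h x); rewrite xA.
  have <- : #|` [fset a * b | b in B]| = #|` B|.
    by rewrite card_imfset//; exact: mulfI.
  apply/fsubset_leq_card/fsubsetP => _ /imfsetP[b /= bB ->].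
  exact: in_imfset2.
by split=> [|B' ? ?]; [exists B | exact: Bmin].
Qed.

Lemma dtimes_min (R : realType) (A : {fset R}) : (2 <= #|` A|)%N ->
  (exists B, B != fset0 /\ sum_ratio A B = dtimes A) /\
  (forall B, B != fset0 -> dtimes A <= sum_ratio A B).
Proof.
move=> A2.
have [|B|[B B0 BE] Bmin] := @inf_ratio R A (sumset A)
    (fun B => B != fset0) (sum_ratio A) erefl (ltnW A2).
- by exists [fset 1]; apply/eqP => /fsetP/(_ 1); rewrite !inE ?eqxx.
- move=> B0; rewrite cardfs_gt0 B0 /=.
  have /fset0Pn[a aA] : A != fset0 by rewrite -cardfs_gt0 ltnW.
  have <- : #|` [fset a + b | b in B]| = #|` B|.
    by rewrite card_imfset//; exact: addrI.
  apply/fsubset_leq_card/fsubsetP => _ /imfsetP[b /= bB ->].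
  exact: in_imfset2.
by split=> [|B' ?]; [exists B | exact: Bmin].
Qed.

(* Main.v *)
(** Let [B] and [C] realise the two minima, with [0] removed from [B].  Each of
    the [|B||C|] lines [y = b (x - c)] contains the [|A|] points [(a + c, a b)]
    of the grid [X * Y], where [X = A + C] and [Y = A B].  Cut [X] and [Y] into
    about [|A|/4] blocks of consecutive elements.  A line is monotone, so it
    meets at most about [|A|/2] cells, and a positive proportion of its points
    share a cell with a later point of the same line.  Since two points
    determine the line, [|A||B||C|] is at most a constant times the number
    [(|X|^2/|A|) (|Y|^2/|A|)] of pairs of grid points in a common cell, that is
    [|A|^3|B||C| = O(|A + C|^2 |A B|^2)]. *)
Require Import Defs.
From mathcomp Require Import all_boot all_order all_algebra finmap.
From mathcomp Require Import all_classical all_reals all_analysis.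
From mathcomp Require Import zify ring lra.

Set Implicit Arguments.
Unset Strict Implicit.

Import Order.TTheory GRing.Theory Num.Theory.
Local Open Scope fset_scope.
Local Open Scope ring_scope.

(** * Counting by fibers and by injections *)

Lemma card_fibers (U V : choiceType) (S : {fset U}) (T : {fset V}) (f : U -> V) :
  (forall s, s \in S -> f s \in T) ->
  #|` S| = (\sum_(t <- T) #|` [fset s in S | f s == t]|)%N.
Proof.
move=> fST.
have E t : #|` [fset s in S | f s == t]| = (\sum_(s <- S) (f s == t))%N.
  rewrite -sum1_size big_fset /=.
  by rewrite [RHS]big_mkcond_idem//= [LHS]big_mkcond/=; apply: eq_bigr => s _; case: eqP.
under eq_bigr do rewrite E.
rewrite exchange_big /= -sum1_size big_seq [RHS]big_seq.
apply: eq_bigr => s sS; rewrite (big_fsetD1 (f s)) ?fST//= eqxx big_seq big1 ?addn0//.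
by move=> t; rewrite !inE => /andP[/negPf]; rewrite eq_sym => ->.
Qed.

Lemma card_le_inj (U V : choiceType) (S : {fset U}) (T : {fset V}) (f : U -> V) :
  (forall s, s \in S -> f s \in T) -> {in S &, injective f} ->
  (#|` S| <= #|` T|)%N.
Proof.
move=> fST finj; rewrite -(card_in_imfset (f := f) imfset_key (p := mem S))//=.
by apply/fsubset_leq_card/fsubsetP => _ /imfsetP[s /= sS ->]; apply: fST.
Qed.

Lemma cardfsM (U V : choiceType) (A : {fset U}) (B : {fset V}) :
  #|` A `*` B| = (#|` A| * #|` B|)%N.
Proof.
rewrite -(size_allpairs pair); apply/perm_size/uniq_perm => //.
  by apply: allpairs_uniq => // -[? ?] [? ?].
move=> [x y]; rewrite in_fsetM /=; apply/andP/allpairsP.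
  by case=> xA yB; exists (x, y).
by case=> -[x' y'] /= [xA yB [-> ->]].
Qed.

Lemma card_iota m : #|` [fset i in iota 0 m]| = m.
Proof. by rewrite card_fseq undup_id ?iota_uniq// size_iota. Qed.

(** * Blocks of consecutive elements of a finite set of reals *)

Section Blocks.
Context (R : realType).
Implicit Types (X A : {fset R}) (x y a : R).

Definition rank X x := #|` [fset y in X | y < x]|.

Lemma rank_le X x y : x <= y -> (rank X x <= rank X y)%N.
Proof.
move=> xy; apply/fsubset_leq_card/fsubsetP => z; rewrite !inE => /andP[-> /=].
by move=> zx; exact: lt_le_trans xy.
Qed.

Lemma rank_lt X x y : x \in X -> x < y -> (rank X x < rank X y)%N.
Proof.
move=> xX xy; apply: fproper_ltn_card; rewrite fproperE; apply/andP; split; last first.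
  by apply/fsubsetPn; exists x; rewrite !inE xX ?xy ?ltxx.
apply/fsubsetP => z; rewrite !inE => /andP[-> /= zx]; exact: lt_trans xy.
Qed.

Lemma rank_inj X : {in X &, injective (rank X)}.
Proof.
move=> x y xX yX E; case: (ltgtP x y) => // h.
  by have := rank_lt xX h; rewrite E ltnn.
by have := rank_lt yX h; rewrite E ltnn.
Qed.

Lemma rank_card X x : x \in X -> (rank X x < #|` X|)%N.
Proof.
move=> xX; apply: fproper_ltn_card; rewrite fproperE; apply/andP; split; last first.
  by apply/fsubsetPn; exists x; rewrite // !inE ltxx andbF.
by apply/fsubsetP => z; rewrite !inE => /andP[].
Qed.

Definition block X m x := (rank X x %/ m)%N.

Lemma block_le X m x y : x <= y -> (block X m x <= block X m y)%N.
Proof. by move=> xy; exact/leq_div2r/rank_le. Qed.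

Definition block_pairs X m :=
  [fset p in X `*` X | block X m p.1 == block X m p.2].

(** Within a known block, the rank modulo [m] identifies an element, so a pair is encoded by its
    first entry and one residue. *)
Lemma card_block_pairs X m : (0 < m)%N ->
  (#|` block_pairs X m| <= #|` X| * m)%N.
Proof.
move=> m0; rewrite -[X in (_ * X)%N](card_iota m) -cardfsM.
apply: (card_le_inj (f := fun p => (p.1, rank X p.2 %% m)%N)).
  move=> p; rewrite !inE /= => /andP[/andP[-> _] _] /=.
  by rewrite mem_iota add0n ltn_mod.
move=> [x1 x2] [y1 y2]; rewrite !inE /= => /andP[/andP[_ x2X] /eqP ex].
move=> /andP[/andP[_ y2X] /eqP ey] [exy em]; congr pair => //.
apply: (@rank_inj X) => //.
rewrite (divn_eq (rank X x2) m) (divn_eq (rank X y2) m) em.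
by move: ex ey; rewrite /block exy => -> ->.
Qed.

(** An element left out is the largest of its fiber under [h], and there are at most [q.+1]
    fibers. *)
Lemma card_nonlast A (h : R -> nat) q : (forall a, a \in A -> h a <= q)%N ->
  (#|` A| <=
   #|` [fset a in A | `[< exists2 a', a' \in A & (a < a')%R /\ h a = h a' >]]| + q.+1)%N.
Proof.
move=> hq; set G := [fset a in A | _].
rewrite -(cardfsID G A); apply: leq_add.
  by apply/fsubset_leq_card/fsubsetIr.
rewrite -[q.+1]card_iota; apply: (card_le_inj (f := h)).
  by move=> a; rewrite in_fsetD => /andP[_ /hq haq]; rewrite !in_fset mem_iota; lia.
move=> a a'; rewrite !inE => /andP[+ aA] /andP[+ a'A] E.
rewrite (aA : a \in mem_fin _) (a'A : a' \in mem_fin _) /= => /asboolP n1 /asboolP n2.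
by case: (ltgtP a a') => // h'; exfalso; [apply: n1; exists a' | apply: n2; exists a].
Qed.

(** The successor makes [4 * N < n * block_size n N] strict, which keeps every block index of an
    [N]-element set below [n / 4]. *)
Definition block_size n N := ((4 * N) %/ n).+1.

Lemma block_bound X n x : (0 < n)%N -> x \in X ->
  (block X (block_size n #|` X|) x <= (n.-1) %/ 4)%N.
Proof.
move=> n0 /rank_card; rewrite /block /block_size.
set r := rank X x; set N := #|` X| => rN.
rewrite leq_divRL//; set m := ((4 * N) %/ n).+1.
have h1 := leq_divM r m.
have h2 : (4 * N < m * n)%N by rewrite /m -ltn_divLR.
rewrite -ltnS prednK// ltnNge; apply/negP => nf.
have : (m * n <= m * (r %/ m * 4))%N by rewrite leq_mul2l nf orbT.
lia.
Qed.

Lemma block_size_le n N : (n <= N)%N -> (n * block_size n N <= 5 * N)%N.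
Proof.
by move=> nN; rewrite /block_size mulnS mulnC; have := leq_divM (4 * N) n; lia.
Qed.

End Blocks.

(** * Pairs of grid points in a common cell *)

Lemma sum_prod_incidence (R : realType) (A B C : {fset R}) :
  (2 <= #|` A|)%N -> B != fset0 -> C != fset0 -> 0 \notin B ->
  (#|` A| ^ 3 * (#|` B| * #|` C|) <=
   100 * (#|` prodset A B| ^ 2 * #|` sumset A C| ^ 2))%N.
Proof.
move=> A2 B0 C0 nB0.
have bn0 b : b \in B -> b != 0 by apply: contraTneq => ->.
set X := sumset A C; set Y := prodset A B; set n := #|` A|.
have XP a c : a \in A -> c \in C -> a + c \in X.
  by move=> aA cC; exact: in_imfset2.
have YP a b : a \in A -> b \in B -> a * b \in Y.
  by move=> aA bB; exact: in_imfset2.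
have nX : (n <= #|` X|)%N.
  have /fset0Pn[c cC] := C0.
  by apply: (card_le_inj (f := fun a => a + c)) => [a aA|a a' _ _ /addIr]; rewrite ?XP.
have nY : (n <= #|` Y|)%N.
  have /fset0Pn[b bB] := B0.
  apply: (card_le_inj (f := fun a => a * b)) => [a aA|a a' _ _]; first exact: YP.
  exact/mulIf/bn0.
have n0 : (0 < n)%N by exact: ltnW.
set mX := block_size n #|` X|; set mY := block_size n #|` Y|.
set q := (n.-1 %/ 4)%N.
(* The triple [t = (a, (b, c))] encodes the point [(a + c, a * b)] on the line given by [(b, c)]. *)
pose later (t : R * (R * R)) a' := [/\ a' \in A, t.1 < a',
  block X mX (t.1 + t.2.2) = block X mX (a' + t.2.2) &
  block Y mY (t.1 * t.2.1) = block Y mY (a' * t.2.1)].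
pose S := [fset t in A `*` (B `*` C) | `[< exists a', later t a' >]].
have lowS : (#|` B| * #|` C| * (n - (q + q).+1) <= #|` S|)%N.
  rewrite (card_fibers (T := B `*` C) (f := snd)); last first.
    by move=> t; rewrite !inE => /andP[/andP[_ ->]].
  rewrite -cardfsM -sum1_size big_distrl /=.
  rewrite big_seq [X in (_ <= X)%N]big_seq; apply: leq_sum => -[b c].
  rewrite !inE /= mul1n => /andP[bB cC].
  (* The blocks along [Y] are numbered backwards when the line decreases, so
     that [h] is a sum of two nondecreasing functions of [a]. *)
  pose g a := if 0 < b then block Y mY (a * b) else (q - block Y mY (a * b))%N.
  pose h a := (block X mX (a + c) + g a)%N.
  have gq a : a \in A -> (block Y mY (a * b) <= q)%N.
    by move=> aA; apply: block_bound => //; exact: YP.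
  have hq a : a \in A -> (h a <= q + q)%N.
    move=> aA; apply: leq_add; first by apply: block_bound => //; exact: XP.
    by rewrite /g; case: ifP => _; [exact: gq | exact: leq_subr].
  have := card_nonlast hq; rewrite -/n [X in (_ <= X)%N]addnC -leq_subLR => /leq_trans; apply.
  apply: (card_le_inj (f := fun a => (a, (b, c)))); last by move=> ? ? _ _ [].
  move=> a; rewrite !inE /= => /andP[aA /asboolP[a' a'A [aa' haa']]].
  rewrite aA bB cC eqxx /= andbT; apply/asboolP; exists a'.
  (* Neither summand of [h] decreases from [a] to [a'], so equal sums force equal summands. The
     bound [q] keeps the truncated subtraction in [g] injective. *)
  have fle : (block X mX (a + c) <= block X mX (a' + c))%N.
    by apply: block_le; rewrite lerD2r ltW.
  have := gq _ aA; have := gq _ a'A; move: haa'; rewrite /h /g /later /=.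
  case: ifPn => b0 E l1 l2.
    have : (block Y mY (a * b) <= block Y mY (a' * b))%N.
      by apply: block_le; apply: ler_wpM2r; exact: ltW.
    by split=> //; lia.
  have : (block Y mY (a' * b) <= block Y mY (a * b))%N.
    by apply: block_le; apply: ler_wnM2r; [rewrite leNgt | exact: ltW].
  by split=> //; lia.
have upS : (#|` S| <= (#|` X| * mX) * (#|` Y| * mY))%N.
  have [s sP] : {s : R * (R * R) -> R & forall t, t \in S -> later t (s t)}.
    apply: cid; have [|s sP] := @choice _ _ (fun t a' => t \in S -> later t a').
      move=> t; case: (boolP (t \in S)) => [|_]; last by exists 0.
      by rewrite !inE => /andP[_ /asboolP[a' ?]]; exists a'.
    by exists s.
  apply: (@leq_trans (#|` block_pairs X mX| * #|` block_pairs Y mY|)); last first.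
    by apply: leq_mul; exact: card_block_pairs.
  rewrite -cardfsM.
  apply: (card_le_inj (f := fun t =>
    ((t.1 + t.2.2, s t + t.2.2), (t.1 * t.2.1, s t * t.2.1)))).
    move=> t tS; have [sA _ eX eY] := sP _ tS.
    move: tS; rewrite !inE /= => /andP[/and3P[aA bB cC] _].
    by rewrite !XP ?YP//= eX eY !eqxx.
  move=> t1 t2 t1S t2S; have [_ lt1 _ _] := sP _ t1S.
  move: t1S t2S; rewrite !inE /= => /andP[/and3P[_ bB _] _] _.
  case: t1 t2 (s t1) (s t2) lt1 bB => [a1 [b1 c1]] [a2 [b2 c2]] s1 s2 /=.
  move=> lt1 bB [e1 e2 e3 e4].
  (* The two triples give the same nonzero horizontal gap and the same vertical gap, hence the same
     slope [b]; as [b1] is nonzero, the ordinate then gives [a], and the abscissa [c]. *)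
  have d0 : s1 - a1 != 0 by rewrite subr_eq0 gt_eqF.
  have d : s1 - a1 = s2 - a2 by lra.
  have eb : b1 = b2.
    by apply: (mulfI d0); rewrite [in RHS]d !mulrBl e3 e4.
  have ea : a1 = a2 by apply: (mulIf (bn0 _ bB)); rewrite e3 eb.
  by rewrite ea eb; congr (_, (_, _)); lra.
have key := leq_trans lowS upS.
(* Since [4 * q <= n - 1], at least [(n - 1) / 2] points per line remain, which is at least [n / 4]
   for [n >= 2]. *)
have kn : (n <= 4 * (n - (q + q).+1))%N.
  by have := leq_divM n.-1 4; rewrite -/q => ?; lia.
(* One factor [n] goes to each block size, at a cost of 5 each; with the 4 of [kn] this makes
   100. *)
apply: (@leq_trans (n ^ 2 * (4 * (#|` B| * #|` C| * (n - (q + q).+1))))).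
  rewrite (expnS n 2) (mulnC n) -mulnA leq_mul2l; apply/orP; right.
  by rewrite mulnC mulnCA leq_mul2l kn orbT.
apply: (@leq_trans (4 * ((#|` X| * (n * mX)) * (#|` Y| * (n * mY))))).
  rewrite mulnCA leq_mul2l /=.
  apply: leq_trans (leq_mul (leqnn _) key) _.
  by rewrite -mulnn; apply/eq_leq; ring.
apply: leq_trans (leq_mul (leqnn 4) (leq_mul (leq_mul (leqnn _) (block_size_le nX))
  (leq_mul (leqnn _) (block_size_le nY)))) _.
by rewrite -!mulnn; apply/eq_leq; ring.
Qed.

Theorem theorem23 (R : realType) :
  exists K c : R, [/\ 0 < K, 0 < c &
    forall A : {fset R}, (2 <= #|` A|)%N ->
      #|` A|%:R <= K * (dplus A * dtimes A) * (ln #|` A|%:R) `^ c].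
Proof.
have ln2 : 0 < ln 2 :> R by rewrite ln_gt0// ltr1n.
(* The 200 is 100 doubled by the removal of [0] from [B]; dividing by [ln 2] makes the logarithmic
   factor at least 1. *)
exists (200 / ln 2), 1; split=> [||A A2]; rewrite ?divr_gt0//.
have [[B [B0 B1 <-]] _] := dplus_min A2.
have [[C [C0 <-]] _] := dtimes_min A2.
rewrite /prod_ratio /sum_ratio.
have lnA : ln 2 <= ln #|` A|%:R :> R.
  by rewrite ler_ln ?posrE ?ltr0n ?ler_nat// ltnW.
rewrite powRr1; last exact: le_trans (ltW ln2) lnA.
(* As [B] is neither empty nor [[fset 0]], some element survives, and at most half of [B] is
   lost. *)
pose B' := B `\ 0.
have B'0 : B' != fset0.
  apply: contra B1; rewrite fsetD_eq0 fsubset1 => /orP[//|].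
  by rewrite (negPf B0).
have BB' : (#|` B| <= 2 * #|` B'|)%N.
  by have := cardfsD1 0 B; rewrite -/B'; move: B'0; rewrite -cardfs_gt0; lia.
have YY' : (#|` prodset A B'| <= #|` prodset A B|)%N.
  apply/fsubset_leq_card/fsubsetP => _ /imfset2P[a /= aA [b + ->]].
  by rewrite !inE => /andP[_ bB]; exact: in_imfset2.
have nB' : 0 \notin B' by rewrite !inE eqxx.
have key := sum_prod_incidence A2 B'0 C0 nB'.
have {}key : (#|` A| ^ 3 * (#|` B| * #|` C|) <=
    200 * (#|` prodset A B| ^ 2 * #|` sumset A C| ^ 2))%N.
  apply: (@leq_trans (2 * (#|` A| ^ 3 * (#|` B'| * #|` C|)))).
    by rewrite [X in (_ <= X)%N]mulnCA leq_mul2l mulnA leq_mul2r BB' !orbT.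
  apply: leq_trans (leq_mul (leqnn 2) key) _; rewrite mulnA.
  by apply: leq_mul => //; rewrite leq_mul2r leq_exp2r// YY' orbT.
rewrite -cardfs_gt0 in B0; rewrite -cardfs_gt0 in C0.
have A0 := ltnW A2.
set n := #|` A|; set y := #|` prodset A B|; set x := #|` sumset A C|.
rewrite -(ler_nat R) !natrM in key.
have [a0 b0 c0] : [/\ 0 < n%:R :> R, 0 < #|` B|%:R :> R & 0 < #|` C|%:R :> R].
  by rewrite !ltr0n.
set D := y%:R ^+ 2 / _ * _.
have nD : n%:R <= 200 * D.
  rewrite /D mulf_div mulrA ler_pdivlMr ?mulr_gt0//.
  by apply: le_trans key; rewrite le_eqVlt; apply/orP; left; apply/eqP; ring.
have D0 : 0 <= D by rewrite /D !mulr_ge0 ?invr_ge0 ?mulr_ge0 ?ler0n// ltW.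
apply: (le_trans nD).
rewrite (_ : 200 / ln 2 * D * _ = 200 * D * (ln n%:R / ln 2)); last by ring.
by rewrite ler_peMr ?mulr_ge0// ler_pdivlMr// mul1r.
Qed.
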